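(* Let $\beta>(1+\sqrt5)/2$. Then the countable matrix $A_{-\beta}$ (the incidence matrix of the Markov diagram of the $(-\beta)$-transformation) is positive recurrent.
   Context: Let $\beta>1$, $\ell_\beta=-\frac{\beta}{\beta+1}$, $r_\beta=\frac1{\beta+1}$, $\mathcal A=\{0,1,\dots,\lfloor\beta\rfloor\}$, $\mathbb N=\{1,2,\dots\}$. The $(-\beta)$-transformation on $[\ell_\beta,r_\beta)$ is $T_{-\beta}(x)=-\beta x-\lfloor-\beta x-\ell_\beta\rfloor$. For $x\in[\ell_\beta,r_\beta)$ let $d(x,-\beta)=d_1d_2\cdots\in\mathcal A^{\mathbb N}$ with $d_i=\lfloor-\beta T_{-\beta}^{i-1}(x)-\ell_\beta\rfloor$, and let $b_1b_2b_3\cdots=d^*(\ell_\beta,-\beta):=\lim_{x\searrow\ell_\beta}d(x,-\beta)$ (limit in the product topology). Markov diagram: a labelled directed graph with vertex (state) set $\{0,1,2,\dots\}$, whose edges are exactly the following (an edge with the same source, target and label that is listed more than once is counted once). (i) $0\xrightarrow{i}0$ for $i\in\{0,\dots,b_1-1\}$; $1\xrightarrow{b_1}1$; $m\xrightarrow{b_{m+1}}m+1$ for all $m\ge0$. (ii) Further edges are produced by the following infinite procedure, started at $m=1$. Case I: $m$ is even, or $m$ is odd and $b_{m+1}\ne b_1$. If $m$ is even, draw $m\xrightarrow{i}0$ for $i\in\{0,\dots,b_{m+1}-1\}$. If $m$ is odd, draw $m\xrightarrow{i}0$ for $i\in\{b_{m+1}+1,\dots,b_1-1\}$ and $m\xrightarrow{b_1}1$.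 Then replace $m$ by $m+1$ and repeat. Case II: $m$ is odd and $b_{m+1}=b_1,\ b_{m+2}=b_2,\dots,b_{m+n-1}=b_{n-1},\ b_{m+n}\ne b_n$ with some $2\le n\le m$ (for odd $m$ reached by the procedure with $b_{m+1}=b_1$ such an $n$ always exists). Put $s=m+n-1$ (so $s\equiv n \bmod 2$). Draw $s\xrightarrow{b_n}n$; and draw $s\xrightarrow{i}0$ for $i\in\{b_n+1,\dots,b_{s+1}-1\}$ if $n,s$ are even, respectively for $i\in\{b_{s+1}+1,\dots,b_n-1\}$ if $n,s$ are odd. Then replace $m$ by $s+1$ and repeat. $A_{-\beta}=(a_{ij})_{i,j\ge0}$, where $a_{ij}$ is the number of edges from state $i$ to state $j$. For an irreducible aperiodic nonnegative countable matrix $A$, its Perron value is $\lambda=\lim_{n\to\infty}\sqrt[n]{(A^n)_{ij}}$ (independent of $i,j$). $A$ is recurrent if $\sum_{n\ge0}(A^n)_{ii}\lambda^{-n}=\infty$. Let $\ell_{ij}(0)=0$, $\ell_{ij}(1)=A_{ij}$, $\ell_{ij}(n+1)=\sum_{r\ne i}\ell_{ir}(n)A_{rj}$. A recurrent $A$ is positive recurrent if $\sum_{n\ge1}n\,\ell_{ii}(n)\lambda^{-n}<\infty$ (finiteness and recurrence do not depend on $i$). *)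

(* Defs.v *)
From HB Require Import structures.
From mathcomp Require Import all_boot all_order all_algebra finmap.
From mathcomp Require Import all_classical all_reals all_analysis.

Set Implicit Arguments.
Unset Strict Implicit.
Unset Printing Implicit Defensive.

Import Order.TTheory GRing.Theory Num.Theory.
Import numFieldNormedType.Exports.

Local Open Scope classical_set_scope.
Local Open Scope ring_scope.

Definition digit_sequence : Type := prod_topology (fun _ : nat => nat).
HB.instance Definition _ := Pointed.on digit_sequence.
HB.instance Definition _ := Nbhs.on digit_sequence.
HB.instance Definition _ := Topological.on digit_sequence.

Section NegBetaTransformation.
Context {R : realType}.
Variable beta : R.

Definition lbeta : R := - (beta / (beta + 1)).

Definition first_digit (x : R) : int := Num.floor (- beta * x - lbeta).

(* The transformation acts on [lbeta, rbeta), rbeta = (beta + 1)^-1, and maps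
   this interval into itself; its values elsewhere are irrelevant. *)
Definition neg_beta_transform (x : R) : R := - beta * x - (first_digit x)%:~R.

(* Sequences of digits d_1 d_2 ... are indexed from 1: the entry of index 0
   (a copy of d_1, since 0.-1 = 0) is a dummy that is never read below.
   On [lbeta, rbeta) first_digit is nonnegative, so absz only changes the
   type. *)
Definition neg_beta_expansion (x : R) : digit_sequence :=
  fun i => `|first_digit (iter i.-1 neg_beta_transform x)|%N.

(* limit in the product of the discrete topologies, x decreasing to lbeta *)
Definition quasi_expansion : nat -> nat :=
  lim (neg_beta_expansion x @[x --> lbeta^'+]).

End NegBetaTransformation.

Section MarkovDiagram.
Variable b : nat -> nat.

Definition caseI (m : nat) : bool := ~~ odd m || (b m.+1 != b 1).

Definition caseII (m n : nat) : Prop :=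
  [/\ odd m, (2 <= n <= m)%N,
      forall k, (1 <= k < n)%N -> b (m + k) = b k & b (m + n) <> b n].

(* values of m visited by the procedure that draws the edges; in case II the
   next value is s + 1 = m + n *)
Inductive visited : nat -> Prop :=
| visited_start : visited 1
| visited_I m : visited m -> caseI m -> visited m.+1
| visited_II m n : visited m -> caseII m n -> visited (m + n).

(* edge p i q: there is an edge from p to q with label i; being a relation,
   it counts an edge drawn several times only once *)
Inductive edge : nat -> nat -> nat -> Prop :=
| edge_00 i : (i < b 1)%N -> edge 0 i 0
| edge_11 : edge 1 (b 1) 1
| edge_succ m : edge m (b m.+1) m.+1
| edge_I_even m i : visited m -> caseI m -> ~~ odd m ->
    (i < b m.+1)%N -> edge m i 0
| edge_I_odd0 m i : visited m -> caseI m -> odd m ->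
    (b m.+1 < i < b 1)%N -> edge m i 0
| edge_I_odd1 m : visited m -> caseI m -> odd m -> edge m (b 1) 1
| edge_II m n s : visited m -> caseII m n -> s = (m + n).-1 ->
    edge s (b n) n
| edge_II_even m n s i : visited m -> caseII m n -> s = (m + n).-1 ->
    ~~ odd n -> (b n < i < b s.+1)%N -> edge s i 0
| edge_II_odd m n s i : visited m -> caseII m n -> s = (m + n).-1 ->
    odd n -> (b s.+1 < i < b n)%N -> edge s i 0.

(* Every label out of p is at most b k for some 1 <= k <= p + 1, so the set of
   labels is finite and fset_set does not default to the empty set. *)
Definition edge_count (p q : nat) : nat :=
  #|` fset_set [set i : nat | edge p i q]|.

End MarkovDiagram.

Definition incidence_matrix (R : realType) (beta : R) (i j : nat) : R :=
  (edge_count (quasi_expansion beta) i j)%:R.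

Section CountableMatrices.
Context {R : realType}.
Variable A : nat -> nat -> R.

Local Open Scope ereal_scope.

(* Entries of powers of a nonnegative countable matrix are sums of series,
   whence the values in \bar R. *)
Fixpoint cmx_pow (n : nat) (i j : nat) : \bar R :=
  if n is n'.+1 then \sum_(0 <= r <oo) cmx_pow n' i r * (A r j)%:E
  else ((i == j)%:R)%:E.

(* cmx_first i n j is ell_{ij}(n): paths of length n from i to j that do not
   return to i before time n. *)
Fixpoint cmx_first (i n j : nat) : \bar R :=
  match n with
  | 0%N => 0
  | 1%N => (A i j)%:E
  | n'.+1 => \sum_(0 <= r <oo | r != i) cmx_first i n' r * (A r j)%:E
  end.

Definition cmx_irreducible : Prop :=
  forall i j, exists2 n, (0 < n)%N & 0 < cmx_pow n i j.

Definition cmx_aperiodic : Prop :=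
  forall i d, (forall n, 0 < cmx_pow n i i -> (d %| n)%N) -> d = 1%N.

(* The root of index 0 is 1, which does not affect the limit. *)
Definition is_perron_value (lambda : R) : Prop :=
  forall i j, poweR (cmx_pow n i j) (n%:R^-1)%R @[n --> \oo] --> lambda%:E.

Definition cmx_recurrent (lambda : R) : Prop :=
  forall i, \sum_(0 <= n <oo) cmx_pow n i i * (lambda ^- n)%:E = +oo.

Definition cmx_positive_recurrent : Prop :=
  [/\ forall i j, (0 <= A i j)%R, cmx_irreducible, cmx_aperiodic &
      exists lambda : R,
        [/\ is_perron_value lambda, cmx_recurrent lambda &
            forall i, \sum_(1 <= n <oo)
              n%:R%:E * cmx_first i n i * (lambda ^- n)%:E < +oo]].

End CountableMatrices.

(* Main.v *)
(** Let [c n] be the one-sided orbit of [lbeta], whose digits are the sequence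
    [b].  Every vertex of the diagram carries an interval with endpoints in the
    orbit, and the edges record how the transformation, which expands by [beta],
    cuts the interval of a vertex into intervals of its successors; the lengths
    of these intervals therefore form a bounded positive right eigenvector [v]
    for [beta].

    Once the vertex [0] is removed, each vertex has at most two successors, and
    if there are two then one of them is even and visited, hence has a single
    successor.  So the number of paths of length [n] avoiding [0] grows at most
    like the [n]-th power of the golden ratio.

    As the golden ratio is less than [beta], in the Markov chain obtained from
    [v] the time without return to [0] has exponential tails, and the renewal
    equation gives a positive lower bound for [beta ^- n * A^n 0 0], hence for
    all [beta ^- n * A^n i j] with [n] large.  Inserted back into the renewal
    equation at a vertex [i], this lower bound makes the mean return time to
    [i] finite. *)

Require Import Defs.
From mathcomp Require Import all_boot all_order all_algebra finmap.
From mathcomp Require Import all_classical all_reals all_analysis.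
From mathcomp Require Import ring lra zify.
Import Order.TTheory GRing.Theory Num.Theory.
Import numFieldNormedType.Exports.
Local Open Scope ring_scope.

Lemma sum_ord_supp {R : realType} (F : nat -> R) (P : pred nat) (M N : nat) :
  (M <= N)%N -> (forall r, (M <= r)%N -> F r = 0) ->
  \sum_(r < N | P r) F r = \sum_(r < M | P r) F r.
Proof.
move=> MN F0.
rewrite -(big_mkord P F) (big_cat_nat _ (n := M)) //= [X in _ + X]big_nat_cond.
rewrite [X in _ + X]big1 ?addr0 ?big_mkord // => r /andP[/andP[Mr _] _].
exact: F0.
Qed.

(** * Powers of nonnegative band matrices *)

Section BandMatrix.
Context {R : realType}.
Variable A : nat -> nat -> R.
Hypothesis A_ge0 : forall p q, 0 <= A p q.
Hypothesis A_band : forall p q, (p.+1 < q)%N -> A p q = 0.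

(** The band condition confines row [i] of the [n]-th power to columns at most [i + n], so a finite
    sum in [R] can replace the series in [\bar R] of [cmx_pow]. *)
Fixpoint band_pow (n i j : nat) : R :=
  if n is n'.+1 then \sum_(r < (i + n').+1) band_pow n' i r * A r j
  else (i == j)%:R.

Fixpoint band_first (i n j : nat) : R :=
  match n with
  | 0%N => 0
  | 1%N => A i j
  | n'.+1 => \sum_(r < (i + n').+1 | r != i :> nat) band_first i n' r * A r j
  end.

Lemma band_pow0 i j : band_pow 0 i j = (i == j)%:R.
Proof. by []. Qed.

Lemma band_pow_supp n i j : (i + n < j)%N -> band_pow n i j = 0.
Proof.
elim: n i j => [|n IH] i j ij /=.
  by have -> : (i == j) = false by apply/eqP; lia.
rewrite big1 // => r _; rewrite A_band ?mulr0 //.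
by have := ltn_ord r; lia.
Qed.

Lemma band_first_supp i n j : (i + n < j)%N -> band_first i n j = 0.
Proof.
case: n => [|[|n]] ij //=; first by rewrite A_band //; lia.
rewrite big1 // => r _; rewrite (A_band r j) ?mulr0 //.
by have := ltn_ord r; lia.
Qed.

Lemma band_powS n i j N : (i + n < N)%N ->
  band_pow n.+1 i j = \sum_(r < N) band_pow n i r * A r j.
Proof.
move=> iN /=.
rewrite -(sum_ord_supp (fun r => band_pow n i r * A r j) predT _ N) // => r ir.
by rewrite band_pow_supp ?mul0r.
Qed.

Lemma band_firstS i n j N : (i + n.+1 < N)%N ->
  band_first i n.+2 j =
  \sum_(r < N | r != i :> nat) band_first i n.+1 r * A r j.
Proof.
move=> iN; rewrite [LHS]/=.
rewrite -(sum_ord_supp (fun r => band_first i n.+1 r * A r j)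
  (fun r => r != i) _ N) // => r ir.
by rewrite band_first_supp ?mul0r.
Qed.

Lemma band_pow_ge0 n i j : 0 <= band_pow n i j.
Proof.
elim: n i j => [|n IH] i j /=; first exact: ler0n.
by apply: sumr_ge0 => r _; rewrite mulr_ge0.
Qed.

Lemma band_first_ge0 i n j : 0 <= band_first i n j.
Proof.
case: n => [|n] //; elim: n j => [|n IH] j; first exact: A_ge0.
by rewrite (band_firstS _ _ _ _ (ltnSn _)); apply: sumr_ge0 => r _; rewrite mulr_ge0.
Qed.

Lemma band_pow1 i j : band_pow 1 i j = A i j.
Proof.
rewrite (band_powS 0 i j i.+1) ?addn0 //.
rewrite (bigD1 (Ordinal (ltnSn i))) //= eqxx mul1r big1 ?addr0 // => r ri.
have -> : (i == r) = false by apply: contraNF ri => /eqP ir; apply/eqP/val_inj.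
by rewrite mul0r.
Qed.

(** The left side counts only the paths that are at [k] at time [m]. It serves to splice paths in
    lower bounds. *)
Lemma band_pow_mul_le m n i j k :
  band_pow m i k * band_pow n k j <= band_pow (m + n) i j.
Proof.
elim: n j => [|n IH] j.
  rewrite addn0 /=; case: eqP => [->|_]; first by rewrite mulr1.
  by rewrite mulr0 band_pow_ge0.
pose N := (i + m + k + n).+1.
rewrite addnS (band_powS n k j N); last by rewrite /N; lia.
rewrite (band_powS (m + n) i j N); last by rewrite /N; lia.
rewrite mulr_sumr; apply: ler_sum => r _.
by rewrite mulrA ler_wpM2r.
Qed.

(* Decomposition of the paths from [i] according to the last visit to [i]. *)
Lemma band_renewal i n j :
  band_pow n.+1 i j =
  \sum_(k < n.+1) band_pow k i i * band_first i (n.+1 - k) j.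
Proof.
elim: n j => [|n IH] j.
  by rewrite band_pow1 big_ord1 /= eqxx mul1r.
pose N := (i + n).+3.
rewrite (band_powS n.+1 i j N); last by rewrite /N; lia.
have iN : (i < N)%N by rewrite /N; lia.
(* The term [r = i] is the summand with last visit at time [n.+1]; the terms [r != i] extend the
   decomposition given by induction. *)
rewrite (bigD1 (Ordinal iN)) //= -/(band_pow n.+1 i i) big_ord_recr /=.
rewrite subSnn addrC; congr (_ + _).
rewrite (eq_bigr (fun r : 'I_N =>
  \sum_(k < n.+1) band_pow k i i * (band_first i (n.+1 - k) r * A r j))); last first.
  move=> r _; rewrite -/(band_pow n.+1 i r) IH mulr_suml.
  by apply: eq_bigr => k _; rewrite mulrA.
rewrite exchange_big /=; apply: eq_bigr => k _; rewrite -mulr_sumr.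
have kn := ltn_ord k.
have -> : (n.+2 - k = (n - k).+2)%N by lia.
have -> : (n.+1 - k = (n - k).+1)%N by lia.
rewrite (band_firstS i (n - k) j N); last by rewrite /N; lia.
by congr (_ * _); apply: eq_bigl => r; rewrite -val_eqE.
Qed.

Lemma cmx_powE n i j : cmx_pow A n i j = (band_pow n i j)%:E.
Proof.
elim: n i j => [|n IH] i j //=.
rewrite (eq_eseriesr (g := fun r => (band_pow n i r * A r j)%:E)); last first.
  by move=> r _; rewrite IH EFinM.
rewrite (nneseries_split 0 (i + n).+1); last first.
  by move=> k _; rewrite lee_fin mulr_ge0 // band_pow_ge0.
rewrite add0n big_mkord sumEFin eseries0 ?adde0 // => k + _.
by move=> ik; rewrite band_pow_supp ?mul0r.
Qed.

Lemma cmx_firstE i n j : cmx_first A i n j = (band_first i n j)%:E.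
Proof.
case: n => [|n] //; elim: n j => [|n IH] j //.
rewrite -[LHS]/(\sum_(0 <= r <oo | r != i) cmx_first A i n.+1 r * (A r j)%:E)%E.
rewrite (eq_eseriesr (g := fun r => (band_first i n.+1 r * A r j)%:E)); last first.
  by move=> r _; rewrite IH EFinM.
rewrite eseries_mkcond (nneseries_split 0 (i + n.+1).+1); last first.
  by move=> k _; case: ifP => // _; rewrite lee_fin mulr_ge0 // band_first_ge0.
rewrite add0n -big_mkcond big_mkord sumEFin eseries0 ?adde0 // => k + _.
by move=> ik; rewrite band_first_supp ?mul0r //; case: ifP.
Qed.

End BandMatrix.

Arguments band_pow : simpl never.
Arguments band_first : simpl never.

(** * Limits of roots, series and geometric estimates *)

Lemma cvg_root_cst {R : realType} (c lambda : R) : 0 < c ->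
  (c `^ n%:R^-1 * lambda @[n --> \oo] --> lambda)%classic.
Proof.
move=> c0; rewrite -[X in (_ --> X)%classic]mul1r; apply: cvgM; last exact: cvg_cst.
have invn : ((n%:R^-1 : R) @[n --> \oo] --> (0 : R))%classic.
  by rewrite -cvg_shiftS; exact: cvg_harmonic.
have lnn : ((n%:R^-1 * ln c) @[n --> \oo] --> (0 : R))%classic.
  by rewrite -(mul0r (ln c)); apply: cvgM => //; exact: cvg_cst.
have := cvg_comp _ _ lnn (@continuous_expR R 0).
by rewrite expR0 /powR gt_eqF.
Qed.

(** The [n]-th roots of [c] and [C] tend to 1, so a squeeze leaves [lambda]. This turns two-sided
    bounds on powers into the Perron value. *)
Lemma cvg_root_of_bounds {R : realType} (x : nat -> R) (c C lambda : R) (n0 : nat) :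
  0 < c -> 0 < lambda ->
  (forall n, (n0 <= n)%N -> c * lambda ^+ n <= x n <= C * lambda ^+ n) ->
  (poweR (x n)%:E n%:R^-1 @[n --> \oo] --> lambda%:E)%classic.
Proof.
move=> c0 l0 xb; have C0 : 0 < C.
  have /andP[h1 h2] := xb n0 (leqnn n0).
  have := lt_le_trans (mulr_gt0 c0 (exprn_gt0 n0 l0)) (le_trans h1 h2).
  by rewrite pmulr_lgt0 // exprn_gt0.
have rootE a n : 0 < a -> (0 < n)%N ->
    (a * lambda ^+ n) `^ n%:R^-1 = a `^ n%:R^-1 * lambda.
  move=> a0 n0'; rewrite powRM ?exprn_ge0 ?ltW // -powR_mulrn ?ltW // -powRrM.
  by rewrite divff ?pnatr_eq0 -?lt0n // powRr1 // ltW.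
under eq_fun do rewrite poweR_EFin.
apply: cvg_EFin; first exact: nearW.
apply: (squeeze_cvgr _ (cvg_root_cst c lambda c0) (cvg_root_cst C lambda C0)).
near=> n; have n0' : (0 < n)%N by near: n; exists 1%N.
have /xb/andP[h1 h2] : (n0 <= n)%N by near: n; exists n0.
have xn0 : 0 < x n by apply: lt_le_trans h1; rewrite mulr_gt0 // exprn_gt0.
rewrite -!rootE //=; apply/andP; split; apply: ge0_ler_powR;
  rewrite ?nnegrE ?invr_ge0 ?ler0n ?mulr_ge0 ?exprn_ge0 // ltW //.
Unshelve. all: by end_near. Qed.

Lemma nneseries_unbounded {R : realType} (x : nat -> R) (c : R) (n0 : nat) :
  0 < c -> (forall n, 0 <= x n) -> (forall n, (n0 <= n)%N -> c <= x n) ->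
  (\sum_(0 <= n <oo) (x n)%:E = +oo)%E.
Proof.
move=> c0 x0 xc; apply/eqyP => r r0.
have xe0 n : (0 <= n)%N -> predT n -> (0 <= (x n)%:E)%E by rewrite lee_fin.
pose k := Num.bound (r / c).
apply: le_trans (nneseries_lim_ge (n0 + k) xe0).
rewrite sumEFin lee_fin (big_cat_nat _ (n := n0)) //=; last exact: leq_addr.
rewrite -[r]add0r lerD //; first by rewrite sumr_ge0.
apply: (@le_trans _ _ (\sum_(n0 <= n < n0 + k) c)).
  rewrite sumr_const_nat addKn -mulr_natl -ler_pdivrMr //.
  by rewrite ltW // archi_boundP // divr_ge0 // ltW.
by apply: ler_sum_nat => n /andP[/xc].
Qed.

Lemma nneseries_bounded {R : realType} (x : nat -> R) (m : nat) (C : R) :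
  (forall n, 0 <= x n) -> (forall N, \sum_(m <= n < N.+1) x n <= C) ->
  (\sum_(m <= n <oo) (x n)%:E < +oo)%E.
Proof.
move=> x0 xC; apply: (@le_lt_trans _ _ C%:E); last by rewrite ltry.
apply: lime_le; first by apply: is_cvg_nneseries => n _ _; rewrite lee_fin.
apply: nearW => -[|N]; rewrite sumEFin lee_fin //.
by rewrite big_geq // (le_trans _ (xC 0%N)) // sumr_ge0.
Qed.

Lemma geometric_sum_le {R : realType} (rho : R) n : 0 <= rho < 1 ->
  \sum_(j < n) rho ^+ j <= (1 - rho)^-1.
Proof.
move=> /andP[r0 r1]; have r1' : 0 < 1 - rho by rewrite subr_gt0.
rewrite -(ler_pM2l r1') divff ?gt_eqF //.
have -> : (1 - rho) * \sum_(j < n) rho ^+ j = 1 - rho ^+ n.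
  by rewrite -(opprB rho) mulNr -subrX1 opprB.
by rewrite lerBlDr lerDl exprn_ge0.
Qed.

Lemma expr_small {R : realType} (rho e : R) : 0 <= rho < 1 -> 0 < e ->
  exists M, rho ^+ M <= e.
Proof.
move=> /andP[r0 r1] e0.
have /cvgrPdist_le/(_ e e0) [M _ /(_ M (leqnn M))] :
    (rho ^+ n @[n --> \oo] --> 0)%classic.
  by apply: cvg_expr; rewrite ger0_norm.
by rewrite sub0r normrN ger0_norm ?exprn_ge0 //; exists M.
Qed.

(** * The renewal equation *)

Section RenewalEquation.
Context {R : realType}.
Variables (u s : nat -> R) (V : R).
Hypotheses (u_ge0 : forall k, 0 <= u k) (s_ge0 : forall k, 0 <= s k).
Hypothesis renewal : forall n, V = \sum_(k < n.+1) u k * s (n - k).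

Let renewal_rev n : V = \sum_(j < n.+1) u (n - j) * s j.
Proof.
rewrite (renewal n) (reindex_inj rev_ord_inj) /=; apply: eq_bigr => j _.
have := ltn_ord j => jn; rewrite subSS subKn //; lia.
Qed.

(** In the reversed equation the terms [j >= M] add up to at most [V / 2], because [u <= 1] and [s]
    decays geometrically. For [j < M], [u (n - j)] is at most [K ^+ j * u n], so the remaining half
    of [V] is bounded by a constant times [u n]. *)
Lemma renewal_lower_bound (K C rho : R) : 0 < V -> 0 <= K -> 0 <= rho < 1 ->
  (forall k, u k <= 1) -> (forall k, u k <= K * u k.+1) ->
  (forall j, s j <= C * rho ^+ j) ->
  exists2 c, 0 < c & forall n, c <= u n.
Proof.
move=> V_gt0 K0 rho01 u1 uK sC; have /andP[r0 r1] := rho01.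
have C0 : 0 <= C by have := le_trans (s_ge0 0%N) (sC 0%N); rewrite expr0 mulr1.
have r1' : 0 < 1 - rho by rewrite subr_gt0.
have [M rM] : exists M, rho ^+ M <= (1 - rho) * V / (2 * (C + 1)).
  by apply: expr_small => //; rewrite divr_gt0 // ?mulr_gt0 //; lra.
have uKj n j : (j <= n)%N -> u (n - j) <= K ^+ j * u n.
  elim: j => [|j IH] jn; first by rewrite subn0 expr0 mul1r.
  apply: (le_trans (uK _)); have -> : (n - j.+1).+1 = (n - j)%N by lia.
  by rewrite exprS -mulrA ler_wpM2l // IH //; lia.
pose D := \sum_(j < M) K ^+ j * s j.
have D0 : 0 <= D by apply: sumr_ge0 => j _; rewrite mulr_ge0 // exprn_ge0.
exists (V / (2 * (D + 1))) => [|n]; first by rewrite divr_gt0 //; lra.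
(* [G] dominates the terms of the reversed equation and is also defined for [j > n], so the sum can
   be lengthened to [M + n.+1] terms and cut at [M] even when [n < M]. *)
pose G j := if (j < M)%N then u n * (K ^+ j * s j) else C * rho ^+ j.
have G0 j : 0 <= G j.
  by rewrite /G; case: ifP => _; rewrite ?mulr_ge0 // exprn_ge0.
have VG : V <= \sum_(j < n.+1) G j.
  rewrite {1}(renewal_rev n); apply: ler_sum => j _; rewrite /G; case: ifP => _.
    by rewrite mulrA (mulrC (u n)) ler_wpM2r // uKj // -ltnS ltn_ord.
  by rewrite -[leRHS]mul1r ler_pM.
have {}VG : V <= u n * D + C * rho ^+ M / (1 - rho).
  apply: (le_trans VG).
  apply: (@le_trans _ _ (\sum_(j < M + n.+1) G j)).
    by rewrite addnC big_split_ord /= lerDl sumr_ge0.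
  rewrite big_split_ord /=; apply: lerD.
    by rewrite /D mulr_sumr; apply: ler_sum => j _; rewrite /G /= ltn_ord.
  under eq_bigr do rewrite /G /= ltnNge leq_addr /= exprD mulrA.
  by rewrite -mulr_sumr ler_wpM2l ?geometric_sum_le // mulr_ge0 // exprn_ge0.
have : C * rho ^+ M / (1 - rho) <= V / 2.
  apply: (@le_trans _ _ (C * ((1 - rho) * V / (2 * (C + 1))) / (1 - rho))).
    by rewrite ler_wpM2r ?invr_ge0 ?(ltW r1') // ler_wpM2l.
  have -> : C * ((1 - rho) * V / (2 * (C + 1))) / (1 - rho) = V / 2 * (C / (C + 1)).
    by field; apply/andP; split; lra.
  rewrite ler_piMr //; first by rewrite divr_ge0 // ltW.
  by rewrite ler_pdivrMr ?mul1r; lra.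
move=> VC; rewrite ler_pdivrMr; last by lra.
by have := u_ge0 n; lra.
Qed.

(** In the equation at time [N + n0], each term with [j < N] pairs [s j] with a value of [u] beyond
    [n0], hence at least [c]. *)
Lemma renewal_tail_sum (c : R) (n0 N : nat) : 0 < c ->
  (forall k, (n0 <= k)%N -> c <= u k) -> \sum_(j < N) s j <= V / c.
Proof.
move=> c0 cu; rewrite ler_pdivlMr // mulr_suml (renewal_rev (N + n0)).
rewrite -addnS big_split_ord /= -[leLHS]addr0; apply: lerD.
  apply: ler_sum => j _; rewrite mulrC ler_wpM2r // cu //.
  by have := ltn_ord j; lia.
by apply: sumr_ge0 => j _; rewrite mulr_ge0.
Qed.

(** Summation by parts: the mean of a random time is the sum of its tails, here truncated at [N]. *)
Lemma mean_by_tails (f : nat -> R) N :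
  (forall n, s n.+1 + f n.+1 * V = s n) ->
  \sum_(1 <= n < N.+1) n%:R * f n * V + N%:R * s N = \sum_(j < N) s j.
Proof.
move=> fs; elim: N => [|N IH]; first by rewrite big_geq // big_ord0 mul0r addr0.
rewrite big_nat_recr //= big_ord_recr /= -IH.
have := fs N; move: (\sum_(1 <= _ < _) _) (s N) (s N.+1) (f N.+1) => a b c d <-.
by rewrite -natr1; ring.
Qed.

End RenewalEquation.

(** * Positive recurrence from an eigenvector [v] and a weight [w] controlling paths that avoid 0 *)

Section PositiveRecurrence.
Context {R : realType}.
Variables (A : nat -> nat -> R) (v w : nat -> R) (lambda theta : R).
Hypothesis A_ge0 : forall p q, 0 <= A p q.
Hypothesis A_band : forall p q, (p.+1 < q)%N -> A p q = 0.
Hypothesis A_loop : 0 < A 0 0.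
Hypothesis A_succ : forall p, 0 < A p p.+1.
Hypothesis v_gt0 : forall p, 0 < v p.
Hypothesis v_le1 : forall p, v p <= 1.
Hypothesis v_eigen : forall p, \sum_(q < p.+2) A p q * v q = lambda * v p.
Hypothesis w_ge1 : forall p, 1 <= w p.
Hypothesis w_taboo :
  forall p, \sum_(q < p.+2 | q != 0 :> nat) A p q * w q <= theta * w p.
Hypothesis theta_gt0 : 0 < theta.
Hypothesis theta_lt : theta < lambda.

Local Notation pow := (band_pow A).
Local Notation first := (band_first A).

Let lambda_gt0 : 0 < lambda := lt_trans theta_gt0 theta_lt.

Let v_ge0 p : 0 <= v p := ltW (v_gt0 p).

Let pow_ge0 n i j : 0 <= pow n i j := band_pow_ge0 A A_ge0 n i j.

Let w_gt0 p : 0 < w p := lt_le_trans ltr01 (w_ge1 p).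

Let v_eigenN p N : (p.+1 < N)%N -> \sum_(q < N) A p q * v q = lambda * v p.
Proof.
move=> pN; rewrite (sum_ord_supp (fun q => A p q * v q) predT p.+2 N) //.
by move=> q pq; rewrite A_band ?mul0r.
Qed.

Let w_tabooN p N : (p.+1 < N)%N ->
  \sum_(q < N | q != 0 :> nat) A p q * w q <= theta * w p.
Proof.
move=> pN; rewrite (sum_ord_supp (fun q => A p q * w q) (fun q => q != 0%N) p.+2 N) //.
by move=> q pq; rewrite A_band ?mul0r.
Qed.

Lemma band_pow_eigen n i N : (i + n < N)%N ->
  \sum_(j < N) pow n i j * v j = lambda ^+ n * v i.
Proof.
elim: n N => [|n IH] N iN.
  rewrite addn0 in iN; rewrite expr0 mul1r (bigD1 (Ordinal iN)) //= band_pow0 eqxx mul1r.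
  rewrite big1 ?addr0 // => r ri; rewrite band_pow0.
  have -> : (i == r) = false by apply: contraNF ri => /eqP ir; apply/eqP/val_inj.
  by rewrite mul0r.
have iN' : (i + n < N)%N by lia.
under eq_bigr => j _ do rewrite (band_powS A A_band n i j N iN') mulr_suml.
rewrite exchange_big /= exprS -mulrA -(IH N iN') mulr_sumr.
apply: eq_bigr => r _; under eq_bigr do rewrite -mulrA.
rewrite -mulr_sumr; have [ir|ri] := ltnP (i + n) r.
  by rewrite band_pow_supp ?mul0r ?mulr0.
by rewrite v_eigenN 1?mulrCA //; lia.
Qed.

Lemma band_pow_le_eigen n i j : pow n i j * v j <= lambda ^+ n * v i.
Proof.
have jN : (j < (i + n + j).+1)%N by lia.
rewrite -(band_pow_eigen n i (i + n + j).+1); last by lia.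
rewrite (bigD1 (Ordinal jN)) //= lerDl sumr_ge0 // => r _.
by rewrite mulr_ge0.
Qed.

(** The [n]-step return probability to [i] in the chain with transition probabilities
    [A p q * v q / (lambda * v p)]; on the diagonal the factors [v] cancel. *)
Let wt n i : R := pow n i i / lambda ^+ n.

Let wt_ge0 i n : 0 <= wt n i.
Proof. by rewrite divr_ge0 // exprn_ge0 // ltW. Qed.

Let wt_le1 i n : wt n i <= 1.
Proof.
rewrite ler_pdivrMr ?exprn_gt0 // mul1r -(ler_pM2r (v_gt0 i)).
exact: band_pow_le_eigen.
Qed.

(* The weight [v i * P(tau_i > n)] of the paths from [i] that have not
   returned to [i] by time [n], in the Markov chain with transition
   probabilities [A p q * v q / (lambda * v p)]. *)
Definition taboo_tail (i n : nat) : R :=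
  if n is 0 then v i else
  (\sum_(j < (i + n).+1 | j != i :> nat) first i n j * v j) / lambda ^+ n.

Lemma taboo_tailE i n N : (i + n.+1 < N)%N ->
  taboo_tail i n.+1 =
  (\sum_(j < N | j != i :> nat) first i n.+1 j * v j) / lambda ^+ n.+1.
Proof.
move=> iN; rewrite /taboo_tail; congr (_ / _).
rewrite -(sum_ord_supp (fun j => first i n.+1 j * v j) (fun j => j != i) _ N) //.
by move=> j ij; rewrite band_first_supp ?mul0r.
Qed.

Lemma taboo_tail_ge0 i n : 0 <= taboo_tail i n.
Proof.
case: n => [|n]; first exact: v_ge0.
rewrite divr_ge0 ?exprn_ge0 ?(ltW lambda_gt0) // sumr_ge0 // => j _.
by rewrite mulr_ge0 // band_first_ge0.
Qed.

(** The eigenvector equation conserves mass: paths that have not returned by time [n] either return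
    at time [n.+1] or enter the next tail. *)
Lemma taboo_tail_rec i n :
  taboo_tail i n.+1 + first i n.+1 i / lambda ^+ n.+1 * v i = taboo_tail i n.
Proof.
pose N := (i + n).+3; have iN : (i < N)%N by rewrite /N; lia.
have ln k : lambda ^+ k != 0 by rewrite expf_neq0 // gt_eqF.
rewrite (taboo_tailE i n N); last by rewrite /N; lia.
rewrite mulrAC -mulrDl addrC.
have -> : first i n.+1 i * v i +
    \sum_(j < N | j != i :> nat) first i n.+1 j * v j =
    \sum_(j < N) first i n.+1 j * v j.
  by rewrite [RHS](bigD1 (Ordinal iN)) //=; congr (_ + _).
case: n @N iN => [|n] N iN /=.
  rewrite -[LHS]/((\sum_(q < N) A i q * v q) / lambda ^+ 1).
  by rewrite v_eigenN ?expr1 ?mulrK ?unitfE ?gt_eqF // 1?mulrC ?mulKf ?gt_eqF // /N; lia.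
have iN2 : (i + n.+1 < N)%N by rewrite /N; lia.
under eq_bigr => j _ do
  rewrite -[X in X * _]/(first i n.+2 j) (band_firstS A A_band i n j N iN2) mulr_suml.
rewrite exchange_big /= -[RHS]/(taboo_tail i n.+1) (taboo_tailE i n N) //.
rewrite (eq_bigr (fun r : 'I_N => lambda * (first i n.+1 r * v r))); last first.
  move=> r _; under eq_bigr do rewrite -mulrA.
  rewrite -mulr_sumr; have [ir|ri] := ltnP (i + n.+1) r.
    by rewrite band_first_supp ?mul0r ?mulr0.
  rewrite v_eigenN; first by rewrite mulrCA.
  exact: leqW ri.
rewrite -mulr_sumr [lambda ^+ n.+2]exprS invfM mulrACA divff ?gt_eqF //.
by rewrite mul1r.
Qed.

(** Sum [band_renewal] over all endpoints with weights [v]: the mass [v i] is split by the time [k]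
    of the last visit to [i], and the endpoint [i] gives the term [k = n]. *)
Lemma band_pow_renewal i n :
  v i = \sum_(k < n.+1) wt k i * taboo_tail i (n - k).
Proof.
have ln k : lambda ^+ k != 0 by rewrite expf_neq0 // gt_eqF.
case: n => [|n]; first by rewrite big_ord1 /wt band_pow0 eqxx expr0 divr1 mul1r.
pose N := (i + n).+3; have iN : (i < N)%N by rewrite /N; lia.
rewrite big_ord_recr /= subnn -[v i in LHS](mulKf (ln n.+1)).
rewrite -(band_pow_eigen n.+1 i N); last by rewrite /N; lia.
rewrite (bigD1 (Ordinal iN)) //= -/(pow n.+1 i i) mulrDr addrC; congr (_ + _).
  by rewrite /wt mulrA [_ ^- _ * _]mulrC.
rewrite (eq_bigr (fun j : 'I_N => \sum_(k < n.+1)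
    pow k i i * (first i (n.+1 - k) j * v j))); last first.
  move=> j _; rewrite -[X in X * _]/(pow n.+1 i j) band_renewal // mulr_suml.
  by apply: eq_bigr => k _; rewrite mulrA.
rewrite exchange_big /= mulr_sumr; apply: eq_bigr => k _.
have kn := ltn_ord k; have -> : (n.+1 - k = (n - k).+1)%N by lia.
rewrite (taboo_tailE i (n - k) N); last by rewrite /N; lia.
rewrite /wt -mulr_sumr [RHS]mulrACA -invfM -exprD.
have -> : (k + (n - k).+1 = n.+1)%N by lia.
rewrite mulrC; congr (_ * _ * _).
Qed.

(** [w] acts as a Lyapunov function: by [w_taboo], the [w]-mass of the paths avoiding 0 grows by a
    factor at most [theta] per step, and [v <= 1 <= w]. *)
Lemma taboo_tail0_le n : taboo_tail 0 n <= w 0 * (theta / lambda) ^+ n.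
Proof.
have vw p : v p <= w p by exact: le_trans (v_le1 p) (w_ge1 p).
case: n => [|n]; first by rewrite expr0 mulr1; exact: vw.
have first0w : \sum_(j < n.+3 | j != 0 :> nat) first 0 n.+1 j * w j
    <= theta ^+ n.+1 * w 0.
  elim: n => [|n IH]; first by rewrite expr1; apply: w_tabooN.
  have iN2 : (0 + n.+1 < n.+4)%N by lia.
  under eq_bigr => j _ do rewrite (band_firstS A A_band 0 n j _ iN2) mulr_suml.
  rewrite exchange_big /= exprS -mulrA.
  apply: (@le_trans _ _ (\sum_(r < n.+4 | r != 0 :> nat)
      theta * (first 0 n.+1 r * w r))).
    apply: ler_sum => r r0; under eq_bigr do rewrite -mulrA.
    rewrite -mulr_sumr; have [ir|ri] := ltnP (0 + n.+1) r.
      by rewrite band_first_supp ?mul0r ?mulr0.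
    rewrite mulrCA ler_wpM2l ?band_first_ge0 // w_tabooN //; lia.
  rewrite -mulr_sumr ler_wpM2l ?(ltW theta_gt0) //.
  rewrite (sum_ord_supp (fun r => first 0 n.+1 r * w r) (fun r => r != 0%N) n.+3) //.
  by move=> r nr; rewrite band_first_supp ?mul0r //; lia.
rewrite (taboo_tailE 0 n n.+3) // expr_div_n mulrA.
rewrite ler_wpM2r ?invr_ge0 ?exprn_ge0 ?(ltW lambda_gt0) //.
rewrite [leRHS]mulrC (le_trans _ first0w) //.
by apply: ler_sum => j _; rewrite ler_wpM2l // band_first_ge0.
Qed.

(** If [0] were never reached, [w_taboo] would bound the whole mass [lambda ^+ n * v i] by
    [theta ^+ n * w i], which fails for large [n]. *)
Lemma band_pow_reach0 i : exists2 n, (0 < n)%N & 0 < pow n i 0.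
Proof.
apply: contrapT => noreach.
have pow0 n : (0 < n)%N -> pow n i 0 = 0.
  move=> n0; apply/eqP; rewrite eq_le pow_ge0 andbT leNgt.
  by apply/negP => p0; apply: noreach; exists n.
pose N n := (i + n).+2.
have powS n : \sum_(j < N n.+1 | j != 0 :> nat) pow n.+1 i j * w j <=
    theta ^+ n.+1 * w i.
  elim: n => [|n IH].
    rewrite expr1; under eq_bigr => j _ do rewrite band_pow1 //.
    by apply: w_tabooN; rewrite /N; lia.
  have iN2 : (i + n.+1 < N n.+2)%N by rewrite /N; lia.
  under eq_bigr => j _ do rewrite (band_powS A A_band n.+1 i j _ iN2) mulr_suml.
  rewrite exchange_big /= exprS -mulrA.
  apply: (@le_trans _ _ (\sum_(r < N n.+2 | r != 0 :> nat)
      theta * (pow n.+1 i r * w r))).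
    rewrite [leLHS](bigID (fun r : 'I_(N n.+2) => r == 0 :> nat)) /=.
    rewrite big1 => [|r /eqP ->]; last first.
      by rewrite big1 // => j _; rewrite -/(pow n.+1 i 0) pow0 // !mul0r.
    rewrite add0r; apply: ler_sum => r r0; rewrite -/(pow n.+1 i r).
    under eq_bigr do rewrite -mulrA.
    rewrite -mulr_sumr; have [ir|ri] := ltnP (i + n.+1) r.
      by rewrite band_pow_supp ?mul0r ?mulr0.
    rewrite mulrCA ler_wpM2l // w_tabooN //.
    by apply: (@leq_trans (i + n.+1).+3); [exact: leqW ri|rewrite /N; lia].
  rewrite -mulr_sumr ler_wpM2l ?(ltW theta_gt0) //.
  rewrite (sum_ord_supp (fun r => pow n.+1 i r * w r) (fun r => r != 0%N) (N n.+1)) //.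
    by rewrite /N; lia.
  by rewrite /N => r nr; rewrite band_pow_supp ?mul0r //; lia.
have {}powS n : v i <= w i * (theta / lambda) ^+ n.+1.
  rewrite expr_div_n mulrA ler_pdivlMr ?exprn_gt0 // mulrC.
  rewrite -(band_pow_eigen n.+1 i (N n.+1)); last by rewrite /N; lia.
  rewrite mulrC (le_trans _ (powS n)) // (bigID (fun r : 'I_(N n.+1) => r == 0 :> nat)) /=.
  rewrite big1 => [|r /eqP ->]; last by rewrite -/(pow n.+1 i 0) pow0 ?mul0r.
  rewrite add0r; apply: ler_sum => r _; rewrite ler_wpM2l //.
  exact: le_trans (v_le1 r) (w_ge1 r).
have r01 : 0 <= theta / lambda < 1.
  by rewrite divr_ge0 ?ltW //= ltr_pdivrMr // mul1r.
have [M rM] := expr_small (theta / lambda) (v i / (2 * w i)) r01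
  (divr_gt0 (v_gt0 i) (mulr_gt0 (ltr0Sn _ 1) (w_gt0 i))).
have /andP[r0 r1] := r01.
have : v i <= w i * (v i / (2 * w i)).
  apply: (le_trans (powS M)); rewrite ler_wpM2l ?(ltW (w_gt0 i)) //.
  by apply: le_trans rM; rewrite exprS ler_piMl ?exprn_ge0 // ltW.
have -> : w i * (v i / (2 * w i)) = v i / 2 by field; rewrite gt_eqF.
by have := v_gt0 i; lra.
Qed.

Lemma band_pow_from0 j : 0 < pow j 0 j.
Proof.
elim: j => [|j IH]; first exact: ltr01.
have := band_pow_mul_le A A_ge0 A_band j 1 0 j.+1 j.
by rewrite addn1; apply: lt_le_trans; rewrite mulr_gt0 // band_pow1.
Qed.

(** For returns to [0] this is [renewal_lower_bound], with [K = lambda / A 0 0] because appending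
    the loop at [0] lengthens a path by one step. Other pairs follow by splicing a path from [i] to
    [0] and the path [0, 1, ..., j]. *)
Lemma band_pow_lower_bound i j :
  exists2 c, 0 < c & exists n0, forall n, (n0 <= n)%N -> c * lambda ^+ n <= pow n i j.
Proof.
have r01 : 0 <= theta / lambda < 1.
  by rewrite divr_ge0 ?ltW //= ltr_pdivrMr // mul1r.
have [c c0 cu] : exists2 c, 0 < c & forall n, c <= wt n 0.
  apply: (renewal_lower_bound (wt ^~ 0) (taboo_tail 0) (v 0) _ _ _
    (lambda / A 0 0) (w 0) (theta / lambda)) => //.
  - exact: taboo_tail_ge0.
  - exact: band_pow_renewal.
  - by rewrite divr_ge0 // ltW.
  - move=> k; rewrite /wt exprS invfM.
    have -> : lambda / A 0 0 * (pow k.+1 0 0 * (lambda^-1 / lambda ^+ k)) =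
      (pow k.+1 0 0 / A 0 0) / lambda ^+ k.
      by field; rewrite !gt_eqF // exprn_gt0.
    rewrite ler_wpM2r ?invr_ge0 ?exprn_ge0 ?(ltW lambda_gt0) // ler_pdivlMr //.
    by have := band_pow_mul_le A A_ge0 A_band k 1 0 0 0; rewrite addn1 band_pow1.
  - exact: taboo_tail0_le.
have [a a0 ia] := band_pow_reach0 i.
exists (pow a i 0 * c / lambda ^+ (a + j) * pow j 0 j).
  by rewrite mulr_gt0 ?band_pow_from0 // divr_gt0 ?exprn_gt0 // mulr_gt0.
exists (a + j)%N => n ajn; pose k := (n - (a + j))%N.
have -> : n = (a + k + j)%N by rewrite /k; lia.
apply: le_trans (band_pow_mul_le A A_ge0 A_band (a + k) j i j 0).
rewrite mulrAC ler_wpM2r ?(ltW (band_pow_from0 j)) //.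
apply: le_trans (band_pow_mul_le A A_ge0 A_band a k i 0 0).
have -> : (a + k + j = k + (a + j))%N by lia.
rewrite (exprD _ k) mulrACA mulVf ?expf_neq0 ?gt_eqF // mulr1 -mulrA ler_wpM2l //.
by have := cu k; rewrite /wt ler_pdivlMr ?exprn_gt0.
Qed.

Lemma band_first_mean_bounded i : exists C, forall N,
  \sum_(1 <= n < N.+1) n%:R * first i n i * lambda ^- n <= C.
Proof.
have [c c0 [n0 cu]] := band_pow_lower_bound i i.
(* [v i / c] bounds the sum of the tails; the further division by [v i] removes the weight that the
   tails carry. *)
exists (v i / c / v i) => N; rewrite ler_pdivlMr // mulr_suml.
have tails : \sum_(j < N) taboo_tail i j <= v i / c.
  apply: (renewal_tail_sum (wt ^~ i) (taboo_tail i) (v i) (wt_ge0 i)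
    (taboo_tail_ge0 i) (band_pow_renewal i) c n0) => // k n0k.
  by rewrite /wt ler_pdivlMr ?exprn_gt0 // cu.
apply: le_trans tails.
rewrite -(mean_by_tails _ _ (fun n => first i n i / lambda ^+ n) N (taboo_tail_rec i)).
under eq_bigr do rewrite -[_ * _ / _]mulrA.
by rewrite lerDl mulr_ge0 // taboo_tail_ge0.
Qed.

Theorem cmx_positive_recurrent_of_taboo_growth : cmx_positive_recurrent A.
Proof.
split => //.
- move=> i j; have [n n0 ni] := band_pow_reach0 i; exists (n + j)%N.
    by rewrite addn_gt0 n0.
  rewrite cmx_powE // lte_fin.
  apply: lt_le_trans (band_pow_mul_le A A_ge0 A_band n j i j 0).
  by rewrite mulr_gt0 // band_pow_from0.
(* Inserting the loop at [0] into a closed path through [0] makes [d] divide two consecutive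
   lengths. *)
- move=> i d dvd; have [n n0 ni] := band_pow_reach0 i.
  have dn : (d %| n + i)%N.
    apply: dvd; rewrite cmx_powE // lte_fin.
    apply: lt_le_trans (band_pow_mul_le A A_ge0 A_band n i i i 0).
    by rewrite mulr_gt0 // band_pow_from0.
  have : (d %| (n + i) + 1)%N.
    rewrite addnAC; apply: dvd; rewrite cmx_powE // lte_fin.
    apply: lt_le_trans (band_pow_mul_le A A_ge0 A_band (n + 1) i i i 0).
    rewrite mulr_gt0 ?band_pow_from0 //.
    apply: lt_le_trans (band_pow_mul_le A A_ge0 A_band n 1 i 0 0).
    by rewrite mulr_gt0 // band_pow1.
  by rewrite dvdn_addr // dvdn1 => /eqP.
exists lambda; split.
- move=> i j; under eq_fun do rewrite cmx_powE //.
  have [c c0 [n0 cu]] := band_pow_lower_bound i j.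
  apply: (cvg_root_of_bounds _ c (v i / v j) lambda n0) => // n /cu -> /=.
  by rewrite mulrAC ler_pdivlMr // [leRHS]mulrC band_pow_le_eigen.
- move=> i; have [c c0 [n0 cu]] := band_pow_lower_bound i i.
  under eq_eseriesr do rewrite cmx_powE // -EFinM.
  apply: (nneseries_unbounded _ c n0) => // [n|n n0n]; first exact: wt_ge0.
  by rewrite ler_pdivlMr ?exprn_gt0 // cu.
- move=> i; have [C sC] := band_first_mean_bounded i.
  under eq_eseriesr do rewrite cmx_firstE // -!EFinM.
  apply: (nneseries_bounded _ 1 C) => [n|N].
    rewrite mulr_ge0 ?invr_ge0 ?exprn_ge0 ?(ltW lambda_gt0) // mulr_ge0 //.
    exact: band_first_ge0.
  exact: sC.
Qed.

End PositiveRecurrence.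

Lemma edge_count_seq (b : nat -> nat) (s : seq nat) p q : uniq s ->
  (forall i, edge b p i q <-> i \in s) -> edge_count b p q = size s.
Proof.
move=> us es; rewrite /edge_count.
have -> : [set i | edge b p i q]%classic = [set` [fset i in s]%fset]%classic.
  by apply/seteqP; split => i /=; rewrite in_fset => /es.
by rewrite set_fsetK card_fseq undup_id.
Qed.

Lemma sum_delta {R : realType} (N a : nat) (f : nat -> R) : (a < N)%N ->
  \sum_(q < N) (nat_of_ord q == a)%:R * f q = f a.
Proof.
move=> aN; rewrite (bigD1 (Ordinal aN)) //= eqxx mul1r big1 ?addr0 // => q qa.
have -> : (nat_of_ord q == a) = false.
  by apply: contraNF qa => /eqP qa; apply/eqP/val_inj.
by rewrite mul0r.
Qed.

(** * The Markov diagram *)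

Section MarkovDiagramOfOrbit.
Context {R : realType}.
Variables (b : nat -> nat) (c : nat -> R) (beta l r : R).
Hypothesis beta_gt1 : 1 < beta.
Hypothesis r_l : r = l + 1.
Hypothesis l_r : l = - (beta * r).
Hypothesis c0 : c 0 = l.
Hypothesis c_rec : forall n, c n.+1 = - beta * c n - (b n.+1)%:R.
(** In the application [c n] is a one-sided limit of iterates of points just above [l]. The negative
    slope swaps sides at each step: [c n] is approached from above for even [n], from below for odd
    [n]. *)
Hypothesis c_even : forall n, ~~ odd n -> l <= c n < r.
Hypothesis c_odd : forall n, odd n -> l < c n <= r.
Hypothesis b_anti : forall p q, c p < c q -> (b q.+1 <= b p.+1)%N.
Hypothesis b_eq : forall p q, odd p = odd q -> c p = c q -> b p.+1 = b q.+1.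

Let beta_gt0 : 0 < beta := lt_trans ltr01 beta_gt1.

Let b_anti_le p q : odd p = odd q -> c p <= c q -> (b q.+1 <= b p.+1)%N.
Proof.
move=> opq; rewrite le_eqVlt => /predU1P[/b_eq ->//|/b_anti //].
Qed.

Let c_ge n : l <= c n.
Proof. by have [/c_odd/andP[/ltW]|/c_even/andP[]] := boolP (odd n). Qed.

Let c_le n : c n <= r.
Proof. by have [/c_odd/andP[]|/c_even/andP[_ /ltW]] := boolP (odd n). Qed.

(** Allowing [n = 1] lets the odd instances of case I be treated together with case II. *)
Definition mismatch (m n : nat) : Prop :=
  [/\ odd m, (1 <= n <= m)%N,
      forall k, (1 <= k < n)%N -> b (m + k) = b k & b (m + n) <> b n].

(** While the digits agree, both orbits undergo the same affine maps of slope [- beta]. *)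
Lemma orbit_diff m k : (forall i, (1 <= i <= k)%N -> b (m + i) = b i) ->
  c (m + k) - c k = (- beta) ^+ k * (c m - l).
Proof.
elim: k => [|k IH] mb; first by rewrite addn0 c0 expr0 mul1r.
have -> : c (m + k.+1) - c k.+1 = - beta * (c (m + k) - c k).
  by rewrite addnS !c_rec -addnS mb ?leqnn //; ring.
rewrite IH ?exprS ?mulrA // => i /andP[i1 ik]; apply: mb; lia.
Qed.

(** If the digits agreed for [m] steps, the odd parity of [m] would give
    [c (m + m) = c m - beta ^+ m * (c m - l)], which is less than [l]. *)
Lemma mismatch_exists m : odd m -> exists n, mismatch m n.
Proof.
move=> om; have m0 : (0 < m)%N by case: (m) om.
have ex : exists n, (1 <= n <= m)%N && (b (m + n) != b n).
  apply: contrapT => /forallNP nomis.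
  have mb i : (1 <= i <= m)%N -> b (m + i) = b i.
    move=> im; apply/eqP; apply: contraT => bi.
    by case: (nomis i); rewrite im.
  have := orbit_diff m m mb; have := c_ge (m + m).
  rewrite exprNn -signr_odd om expr1 mulN1r.
  have /andP[cm _] := c_odd m om.
  have b1 : 1 < beta ^+ m by rewrite exprn_egt1 // -lt0n.
  have : c m - l < beta ^+ m * (c m - l) by rewrite ltr_pMl // subr_gt0.
  lra.
case: (ex_minnP ex) => n /andP[nm bn] nmin; exists n; split => //; last exact/eqP.
move=> k /andP[k1 kn]; apply/eqP; apply: contraT => bk.
have := nmin k; rewrite k1 bk andbT /=; lia.
Qed.

Lemma mismatch_inj m n n' : mismatch m n -> mismatch m n' -> n = n'.
Proof.
move=> [_ /andP[n1 _] mb bn] [_ /andP[n1' _] mb' bn'].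
have [nn|nn|//] := ltngtP n n'.
  by case: bn; apply: mb'; rewrite n1.
by case: bn'; apply: mb; rewrite n1'.
Qed.

Lemma mismatch_caseI m : odd m -> caseI b m -> mismatch m 1.
Proof.
move=> om; rewrite /caseI om /= => /eqP bm.
split=> //; [by case: (m) om | by case=> // k; rewrite ltnS ltn0 andbF | by rewrite addn1].
Qed.

Lemma caseII_mismatch m n : caseII b m n <-> mismatch m n /\ (2 <= n)%N.
Proof.
split=> [[om /andP[n2 nm] mb bn]|[[om /andP[n1 nm] mb bn] n2]].
  by split=> //; split=> //; rewrite nm (ltnW n2).
by split=> //; rewrite n2.
Qed.

Lemma mismatch_cases m n : mismatch m n ->
  (n = 1%N /\ caseI b m) \/ (caseII b m n /\ (2 <= n)%N).
Proof.
move=> mis; have [om /andP[n1 nm] _ bn] := mis.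
have [n2|n2] := leqP 2 n; first by right; split=> //; apply/caseII_mismatch.
left; have n1' : n = 1%N by lia.
by split=> //; rewrite /caseI; apply/orP; right; apply/eqP; rewrite n1' addn1 in bn.
Qed.

(** * The chain of visited values and its blocks *)

Lemma visited_gt0 m : visited b m -> (0 < m)%N.
Proof.
elim=> // m' n _ m0 _; lia.
Qed.

Lemma visited_mismatch m n : visited b m -> mismatch m n -> visited b (m + n).
Proof.
move=> vm /mismatch_cases [[-> mI]|[mII _]]; last exact: visited_II.
by rewrite addn1; apply: visited_I.
Qed.

Lemma visited_even m : visited b m -> ~~ odd m -> visited b m.+1.
Proof. by move=> vm em; apply: visited_I => //; rewrite /caseI em. Qed.

Definition next_visited (m m' : nat) : Prop :=
  (~~ odd m /\ m' = m.+1) \/ (exists2 n, mismatch m n & m' = (m + n)%N).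

Lemma next_visited_inj m x y : next_visited m x -> next_visited m y -> x = y.
Proof.
move=> [[em ->]|[n mn ->]] [[em' ->]|[n' mn' ->]] //.
- by case: mn'; rewrite (negbTE em).
- by case: mn; rewrite (negbTE em').
- by rewrite (mismatch_inj _ _ _ mn mn').
Qed.

Lemma visited_inv m' : visited b m' ->
  m' = 1%N \/ exists2 m, visited b m & next_visited m m'.
Proof.
case=> [|m vm mI|m n vm mII]; [by left|right; exists m => //..].
  have [om|em] := boolP (odd m); last by left.
  by right; exists 1%N; rewrite ?addn1 //; apply: mismatch_caseI.
by right; exists n => //; have /caseII_mismatch[] := mII.
Qed.

Lemma next_visited_gt m x : next_visited m x -> (m < x)%N.
Proof. by move=> [[_ ->]//|[n [_ /andP[n1 _] _ _] ->]]; lia. Qed.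

(** The visited values form a chain with unique successors; the induction on [m + m'] compares [m]
    with the predecessor of [m']. *)
Lemma next_visited_le m m' x : visited b m -> visited b m' -> (m < m')%N ->
  next_visited m x -> (x <= m')%N.
Proof.
have [k] := ubnP (m + m').
elim: k m m' x => // k IH m m' x mk vm vm' mm' mx.
have [m'1|[m'' vm'' m''m']] := visited_inv _ vm'.
  by have := visited_gt0 _ vm; lia.
have m''lt := next_visited_gt _ _ m''m'.
have [lt|gt|eqm] := ltngtP m m''.
- apply: leq_trans (ltnW m''lt); apply: (IH m) => //; lia.
- have := IH m'' m m' _ vm'' vm gt m''m'; lia.
by rewrite eqm in mx; rewrite (next_visited_inj _ _ _ mx m''m').
Qed.

Lemma block_not_visited m n j : visited b m -> mismatch m n -> (0 < j < n)%N ->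
  ~ visited b (m + j).
Proof.
move=> vm mn /andP[j0 jn] vmj.
have : (m + n <= m + j)%N by apply: (next_visited_le m) => //; [lia|right; exists n].
lia.
Qed.

Lemma block_inj m n j m' n' j' : visited b m -> mismatch m n -> (j < n)%N ->
  visited b m' -> mismatch m' n' -> (j' < n')%N ->
  (m + j = m' + j')%N -> m = m' /\ n = n'.
Proof.
move=> vm mn jn vm' mn' jn' e.
have mm : m = m'.
  have [lt|gt|//] := ltngtP m m'.
    have := next_visited_le m m' (m + n) vm vm' lt; rewrite /next_visited.
    by move=> /(_ (or_intror (ex_intro2 _ _ n mn erefl))); lia.
  have := next_visited_le m' m (m' + n') vm' vm gt; rewrite /next_visited.
  by move=> /(_ (or_intror (ex_intro2 _ _ n' mn' erefl))); lia.
by split=> //; rewrite -mm in mn'; apply: mismatch_inj mn mn'.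
Qed.

(** The remaining vertices are exactly those in the blocks [m, ..., m + n - 1] with [m] odd and
    visited and [mismatch m n]; see [full_or_block] and [full_not_block]. *)
Definition full (p : nat) : Prop := ~~ odd p /\ (p = 0%N \/ visited b p).

Lemma full_or_block p :
  full p \/ exists m n j, [/\ visited b m, mismatch m n, (j < n)%N & p = (m + j)%N].
Proof.
have visited_case q : visited b q ->
    full q \/ exists m n j, [/\ visited b m, mismatch m n, (j < n)%N & q = (m + j)%N].
  move=> vq; have [oq|eq] := boolP (odd q); last by left; split=> //; right.
  have [n mn] := mismatch_exists q oq; right; exists q, n, 0%N; split=> //.
    by case: mn => _ /andP[].
  by rewrite addn0.
elim: p => [|p [[ep [->|vp]]|[m [n [j [vm mn jn ->]]]]]].
- by left; split=> //; left.
- by apply: visited_case; apply: visited_start.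
- by apply: visited_case; apply: visited_even.
have [jn'|nj] := ltnP j.+1 n.
  by right; exists m, n, j.+1; rewrite addnS.
apply: visited_case; have -> : (m + j).+1 = (m + n)%N by lia.
exact: visited_mismatch.
Qed.

Lemma full_not_block m n j : visited b m -> mismatch m n -> (j < n)%N ->
  ~ full (m + j).
Proof.
move=> vm mn jn [emj vmj]; have m0 := visited_gt0 _ vm.
case: j jn emj vmj => [|j] jn emj [|vmj]; try lia.
  by move: emj; rewrite addn0; case: mn => ->.
exact: (block_not_visited m n j.+1).
Qed.

Let negb_pow_odd k : odd k -> (- beta) ^+ k = - beta ^+ k.
Proof. by move=> ok; rewrite exprNn -signr_odd ok expr1 mulN1r. Qed.

Let negb_pow_even k : ~~ odd k -> (- beta) ^+ k = beta ^+ k.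
Proof. by move=> /negbTE ok; rewrite exprNn -signr_odd ok expr0 mul1r. Qed.

Lemma block_diff m n j : mismatch m n -> (j < n)%N ->
  c (m + j) - c j = (- beta) ^+ j * (c m - l).
Proof.
by move=> [_ _ mb _] jn; apply: orbit_diff => i /andP[i1 ij]; apply: mb; lia.
Qed.

Lemma block_even m n j : mismatch m n -> (j < n)%N -> ~~ odd j -> c j < c (m + j).
Proof.
move=> mn jn ej; rewrite -subr_gt0 (block_diff m n) // negb_pow_even //.
have [om _ _ _] := mn; have /andP[cm _] := c_odd m om.
by rewrite mulr_gt0 ?exprn_gt0 // subr_gt0.
Qed.

Lemma block_odd m n j : mismatch m n -> (j < n)%N -> odd j -> c (m + j) < c j.
Proof.
move=> mn jn oj; rewrite -subr_lt0 (block_diff m n) // negb_pow_odd // mulNr oppr_lt0.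
have [om _ _ _] := mn; have /andP[cm _] := c_odd m om.
by rewrite mulr_gt0 ?exprn_gt0 // subr_gt0.
Qed.

(** At the last vertex of the block [c (m + n - 1) < c (n - 1)]. Digits decrease with the point, and
    the mismatch makes the inequality strict. *)
Lemma mismatch_digit_even m n : mismatch m n -> ~~ odd n -> (b n < b (m + n))%N.
Proof.
case: n => [|n] mn en; first by case: mn.
have [_ _ _ bn] := mn.
have := b_anti _ _ (block_odd m n.+1 n mn (ltnSn n) (negbNE en)).
by rewrite -addnS; lia.
Qed.

Lemma mismatch_digit_odd m n : mismatch m n -> odd n -> (b (m + n) < b n)%N.
Proof.
case: n => [|n] mn on //; have [_ _ _ bn] := mn.
have := b_anti _ _ (block_even m n.+1 n mn (ltnSn n) on).
by rewrite -addnS; lia.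
Qed.

(* If [n = m' + j] were inside the block of [m'], the digit [b (m + n)] would
   be compared both with [b n], through [m], and with [b j = b n], through
   [m + m']; the parities of [m] and [m + m'] differ, so that these
   comparisons go in opposite directions. *)
Lemma mismatch_visited m n : visited b m -> mismatch m n -> visited b n.
Proof.
move=> vm mn; have [om /andP[n1 nm] mb bn] := mn.
have vis_of_full : full n -> visited b n by move=> [_ [n0|//]]; lia.
have [//|[m' [n' [[|j] [vm' mn' jn en]]]]] := full_or_block n.
  by rewrite en addn0.
have [om' _ mb' _] := mn'.
have mmb i : (1 <= i <= j)%N -> b (m + m' + i) = b i.
  move=> ij; rewrite -addnA mb; last by lia.
  by apply: mb'; lia.
have cj := orbit_diff (m + m') j mmb.
(* Since [m + m'] is even, [c (m + m')] may equal [l] and the comparisons below are weak; [oe] is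
   the parity that [b_anti_le] needs in case of equality. *)
have c_mm := c_ge (m + m').
have bnj : b n = b j.+1 by rewrite en mb' //; lia.
have oe : odd (m + m' + j) = odd j by rewrite !oddD om om'.
have on : odd n = odd j by rewrite en oddD om' /= negbK.
exfalso; have mne : (m + n = (m + m' + j).+1)%N by lia.
have [oj|ej] := boolP (odd j).
  have h1 := mismatch_digit_odd m n mn; have := h1 (etrans on oj).
  have : c (m + m' + j) <= c j.
    rewrite -subr_le0 cj negb_pow_odd // mulNr oppr_le0.
    by rewrite mulr_ge0 ?subr_ge0 // exprn_ge0 // ltW.
  by move=> /(b_anti_le _ _ oe); rewrite -mne -bnj; lia.
have h1 := mismatch_digit_even m n mn; have := h1 (etrans (congr1 negb on) ej).
have : c j <= c (m + m' + j).
  by rewrite -subr_ge0 cj negb_pow_even // mulr_ge0 ?subr_ge0 // exprn_ge0 // ltW.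
by move=> /(b_anti_le _ _ (esym oe)); rewrite -mne -bnj; lia.
Qed.

(** * Edges and row sums of the incidence matrix *)

Let full0 : full 0.
Proof. by split=> //; left. Qed.

(** The procedure thus starts in case I, whose edge from [1] to [1] coincides with [edge_11]. *)
Let mismatch11 : mismatch 1 1.
Proof.
have [n mn] := mismatch_exists 1 isT.
have n1 : n = 1%N by case: mn => _ /andP[]; lia.
by rewrite n1 in mn.
Qed.

(** Normal form of the nine constructors: the step to [p.+1], the returns to [0] from a full vertex,
    and the edges leaving the last vertex [m + n - 1] of a block. *)
Lemma edgeP p i q : edge b p i q <->
  [\/ q = p.+1 /\ i = b p.+1,
      [/\ full p, q = 0%N & (i < b p.+1)%N] |
      exists m n, [/\ visited b m, mismatch m n, p.+1 = (m + n)%N &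
        (q = n /\ i = b n) \/
        (q = 0%N /\ if odd n then (b p.+1 < i < b n)%N else (b n < i < b p.+1)%N)]].
Proof.
split.
  have sE m n s : caseII b m n -> s = (m + n).-1 -> s.+1 = (m + n)%N.
    by case=> _ /andP[n2 _] _ _ ->; lia.
  case=> {p i q}.
  - by move=> i ib; constructor 2.
  - constructor 3; exists 1%N, 1%N; split=> //; [exact: visited_start|by left].
  - by constructor 1.
  - by move=> m i vm _ em ib; constructor 2; split=> //; split=> //; right.
  - move=> m i vm mI om ib; constructor 3; exists m, 1%N; split=> //.
    + exact: mismatch_caseI.
    + by rewrite addn1.
    + by right.
  - move=> m vm mI om; constructor 3; exists m, 1%N; split=> //.
    + exact: mismatch_caseI.
    + by rewrite addn1.
    + by left.
  - move=> m n s vm mII /(sE _ _ _ mII) se; constructor 3; exists m, n; split=> //.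
      by have /caseII_mismatch[] := mII.
    by left.
  - move=> m n s i vm mII /(sE _ _ _ mII) se en ib; constructor 3; exists m, n; split=> //.
      by have /caseII_mismatch[] := mII.
    by right; rewrite (negbTE en).
  - move=> m n s i vm mII /(sE _ _ _ mII) se on ib; constructor 3; exists m, n; split=> //.
      by have /caseII_mismatch[] := mII.
    by right; rewrite on.
case=> [[-> ->]|[[ep [p0|vp]] -> ib]|[m [n [vm mn pe qi]]]].
- exact: edge_succ.
- by rewrite p0; apply: edge_00; rewrite p0 in ib.
- by apply: edge_I_even => //; rewrite /caseI ep.
have [om _ _ _] := mn.
have [[n1 mI]|[mII n2]] := mismatch_cases _ _ mn.
  have pm : p = m by lia.
  rewrite pm {pe} n1 in qi *; case: qi => [[-> ->]|[-> /= ib]].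
    exact: edge_I_odd1.
  by apply: edge_I_odd0.
have se : p = (m + n).-1 by lia.
case: qi => [[-> ->]|[->]]; first exact: (edge_II vm mII).
have [on|en] := boolP (odd n) => ib; first exact: (edge_II_odd vm mII).
exact: (edge_II_even vm mII).
Qed.

Local Notation A p q := ((edge_count b p q)%:R : R).

Lemma row_full p q : full p ->
  edge_count b p q = ((q == p.+1) + (q == 0) * b p.+1)%N.
Proof.
move=> fp; have noblock m n : visited b m -> mismatch m n -> p.+1 = (m + n)%N -> False.
  move=> vm mn pe; apply: (full_not_block m n n.-1) => //; have [_ /andP[n1 _] _ _] := mn.
    lia.
  by have -> : (m + n.-1)%N = p by lia.
have [->|qp] := eqVneq q p.+1.
  apply: (edge_count_seq b [:: b p.+1]) => // i; rewrite inE edgeP; split.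
    by case=> [[_ ->]|[_ //]|[m [n [vm mn /(noblock _ _ vm mn)]]]].
  by move=> /eqP ->; constructor 1.
have [->|q0] := eqVneq q 0%N.
  rewrite mul1n add0n -[RHS](size_iota 0); apply: edge_count_seq; first exact: iota_uniq.
  move=> i; rewrite mem_iota add0n edgeP; split.
    by case=> [[//]|[_ _ ib]|[m [n [vm mn /(noblock _ _ vm mn)]]]].
  by move=> /= ib; constructor 2.
apply: (edge_count_seq b [::]) => // i; rewrite edgeP; split=> //.
case=> [[qe]|[_ qe]|[m [n [vm mn /(noblock _ _ vm mn)]]]] //.
  by rewrite qe eqxx in qp.
by rewrite qe eqxx in q0.
Qed.

Lemma row_inner m n j q : visited b m -> mismatch m n -> (j.+1 < n)%N ->
  edge_count b (m + j) q = (q == (m + j).+1).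
Proof.
move=> vm mn jn; have jn' := ltnW jn.
have noend m' n' : visited b m' -> mismatch m' n' -> (m + j).+1 = (m' + n')%N -> False.
  move=> vm' mn' e; have [_ /andP[n1 _] _ _] := mn'.
  have e' : (m + j = m' + n'.-1)%N by lia.
  have n1' : (n'.-1 < n')%N by lia.
  have [em en] := block_inj _ _ _ _ _ _ vm mn jn' vm' mn' n1' e'; lia.
have nofull := full_not_block m n j vm mn jn'.
have [->|qp] := eqVneq q (m + j).+1.
  apply: (edge_count_seq b [:: b (m + j).+1]) => // i; rewrite inE edgeP; split.
    by case=> [[_ ->]|[]|[m' [n' [vm' mn' /(noend _ _ vm' mn')]]]].
  by move=> /eqP ->; constructor 1.
apply: (edge_count_seq b [::]) => // i; rewrite edgeP; split=> //.
case=> [[qe]|[]|[m' [n' [vm' mn' /(noend _ _ vm' mn')]]]] //.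
by rewrite qe eqxx in qp.
Qed.

(* The number of integers strictly between [x] and [y]: one of the two
   truncated differences is 0. *)
Definition gap (x y : nat) : nat := (x - y + (y - x)).-1.

Lemma row_end m n p q : visited b m -> mismatch m n -> p.+1 = (m + n)%N ->
  edge_count b p q =
  ((q == p.+1) + (q == n) + (q == 0) * gap (b n) (b p.+1))%N.
Proof.
move=> vm mn pe; have [om /andP[n1 nm] _ _] := mn.
have end_inj m' n' : visited b m' -> mismatch m' n' -> p.+1 = (m' + n')%N -> n' = n.
  move=> vm' mn' pe'; have [_ /andP[n1' _] _ _] := mn'.
  have e' : (m + n.-1 = m' + n'.-1)%N by lia.
  have nn : (n.-1 < n)%N by lia.
  have nn' : (n'.-1 < n')%N by lia.
  by have [] := block_inj _ _ _ _ _ _ vm mn nn vm' mn' nn' e'.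
have nofull : ~ full p.
  have -> : p = (m + n.-1)%N by lia.
  by apply: (full_not_block m n) => //; lia.
have [qp|qp] := eqVneq q p.+1.
  have -> : (q == n) = false by apply/eqP; lia.
  have -> : (q == 0%N) = false by apply/eqP; lia.
  apply: (edge_count_seq b [:: b p.+1]) => // i; rewrite inE edgeP; split.
    case=> [[_ ->]//|[]//|[m' [n' [vm' mn' pe' [[qn _]|[q0 _]]]]]]; last by lia.
    by have := end_inj _ _ vm' mn' pe'; lia.
  by move=> /eqP ->; constructor 1.
have [qn|qn] := eqVneq q n.
  have -> : (q == 0%N) = false by apply/eqP; lia.
  apply: (edge_count_seq b [:: b n]) => // i; rewrite inE edgeP; split.
    case=> [[qp' _]|[]//|[m' [n' [vm' mn' pe' [[qn' ->]|[q0 _]]]]]].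
    - by rewrite qp' eqxx in qp.
    - by rewrite (end_inj _ _ vm' mn' pe').
    - by lia.
  by move=> /eqP ->; constructor 3; exists m, n; split=> //; left.
have [q0|q0] := eqVneq q 0%N.
  rewrite mul1n !add0n.
  pose lo := minn (b n) (b p.+1); pose hi := maxn (b n) (b p.+1).
  have btw i : (if odd n then (b p.+1 < i < b n)%N else (b n < i < b p.+1)%N) <->
      (lo < i < hi)%N.
    rewrite /lo /hi; have [on|en] := boolP (odd n).
      by have := mismatch_digit_odd m n mn on; rewrite -pe; lia.
    by have := mismatch_digit_even m n mn en; rewrite -pe; lia.
  rewrite -[RHS](size_iota lo.+1); apply: edge_count_seq; first exact: iota_uniq.
  move=> i; rewrite mem_iota edgeP.
  have -> : (lo < i < lo.+1 + gap (b n) (b p.+1))%N = (lo < i < hi)%N.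
    by rewrite /gap /lo /hi; lia.
  rewrite -btw; split.
    case=> [[qp' _]|[]//|[m' [n' [vm' mn' pe' [[qn' _]|[_]]]]]].
    - by rewrite qp' eqxx in qp.
    - by have [_ /andP[n1' _] _ _] := mn'; lia.
    - by rewrite (end_inj _ _ vm' mn' pe').
  by move=> ib; constructor 3; exists m, n; split=> //; right.
apply: (edge_count_seq b [::]) => // i; rewrite edgeP; split=> //.
case=> [[qp' _]|[]//|[m' [n' [vm' mn' pe' [[qn' _]|[q0' _]]]]]].
- by rewrite qp' eqxx in qp.
- by rewrite qn' (end_inj _ _ vm' mn' pe') eqxx in qn.
- by rewrite q0' eqxx in q0.
Qed.

Lemma row_sum_full p (f : nat -> R) : full p ->
  \sum_(q < p.+2) A p q * f q = f p.+1 + (b p.+1)%:R * f 0%N.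
Proof.
move=> fp; under eq_bigr do rewrite row_full // natrD natrM mulrDl mulrAC.
by rewrite big_split /= -mulr_suml !sum_delta // mulrC.
Qed.

Lemma row_sum_inner m n j (f : nat -> R) :
  visited b m -> mismatch m n -> (j.+1 < n)%N ->
  \sum_(q < (m + j).+2) A (m + j) q * f q = f (m + j).+1.
Proof.
move=> vm mn jn; under eq_bigr do rewrite (row_inner m n j) //.
by rewrite sum_delta.
Qed.

Lemma row_sum_end m n p (f : nat -> R) :
  visited b m -> mismatch m n -> p.+1 = (m + n)%N ->
  \sum_(q < p.+2) A p q * f q =
  f p.+1 + f n + (gap (b n) (b p.+1))%:R * f 0%N.
Proof.
move=> vm mn pe; under eq_bigr do
  rewrite (row_end m n) // !natrD natrM 2!mulrDl mulrAC.
rewrite !big_split /= -mulr_suml !sum_delta //; first by rewrite mulrC.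
by have [_ /andP[_ nm] _ _] := mn; lia.
Qed.

(* The length of the interval attached to a vertex: [(c p, r)] for the full
   vertices, the interval between [c (m + j)] and [c j] for [p = m + j] in the
   block of [m]. *)
Lemma eigenvector_exists : exists v : nat -> R,
  (forall p, full p -> v p = r - c p) /\
  (forall m n j, visited b m -> mismatch m n -> (j < n)%N ->
    v (m + j)%N = `|c (m + j) - c j|).
Proof.
have /choice[v vP] : forall p, exists x : R, (full p -> x = r - c p) /\
    (forall m n j, visited b m -> mismatch m n -> (j < n)%N ->
      p = (m + j)%N -> x = `|c p - c j|).
  move=> p; have [fp|[m [n [j [vm mn jn pe]]]]] := full_or_block p.
    exists (r - c p); split=> // m n j vm mn jn pe.
    by case: (full_not_block m n j vm mn jn); rewrite -pe.
  exists (`|c p - c j|); split=> [|m' n' j' vm' mn' jn' pe'].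
    by rewrite pe => /(full_not_block m n j vm mn jn).
  have [mm _] := block_inj _ _ _ _ _ _ vm mn jn vm' mn' jn' (etrans (esym pe) pe').
  by have -> : j = j' by lia.
exists v; split=> [p /(proj1 (vP p))//|m n j vm mn jn].
exact: (proj2 (vP (m + j)%N) m n j).
Qed.

Theorem diagram_positive_recurrent (theta : R) :
  1 < theta -> 1 + theta <= theta ^+ 2 -> theta < beta ->
  cmx_positive_recurrent (fun p q => A p q).
Proof.
move=> theta_gt1 theta_sq theta_lt.
have [v [v_full v_block]] := eigenvector_exists.
have v_odd m : visited b m -> odd m -> v m = c m - l.
  move=> vm om; have [n mn] := mismatch_exists m om.
  have n0 : (0 < n)%N by case: mn => _ /andP[].
  have := v_block m n 0%N vm mn n0; rewrite addn0 c0 => ->.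
  by rewrite ger0_norm // subr_ge0.
have v_even m : visited b m -> ~~ odd m -> v m = r - c m.
  by move=> vm em; apply: v_full; split=> //; right.
have v0 : v 0%N = 1 by rewrite v_full // c0 r_l; ring.
have full_next p : full p -> visited b p.+1.
  by move=> [ep [->|vp]]; [exact: visited_start|exact: visited_even].
(* A full vertex has a single nonzero successor, of weight [theta]; the end of a block has two, of
   weights at most [1] and [theta], whence the condition [1 + theta <= theta ^+ 2]. *)
pose w p : R := if `[< full p >] then 1 else theta.
have w_full p : full p -> w p = 1 by move=> /asboolP; rewrite /w => ->.
have w_block m n j : visited b m -> mismatch m n -> (j < n)%N -> w (m + j)%N = theta.
  by move=> vm mn jn; rewrite /w; case: asboolP => // /(full_not_block m n j vm mn jn).
have w_le p : w p <= theta by rewrite /w; case: ifP => // _; exact: ltW.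
have w_ge1 p : 1 <= w p by rewrite /w; case: ifP => // _; exact: ltW.
apply: (@cmx_positive_recurrent_of_taboo_growth R _ v w beta theta) => //.
- move=> p q pq.
  have [fp|[m [n [j [vm mn jn pe]]]]] := full_or_block p.
    have -> : edge_count b p q = 0%N.
      by rewrite row_full //; case: eqP => [|_]; case: eqP => [|_]; lia.
    by [].
  have [jn'|nj] := ltnP j.+1 n.
    rewrite pe in pq *; rewrite (row_inner m n j) //.
    by have -> : (q == (m + j).+1) = false by apply/eqP; lia.
  have [_ /andP[n1 nm] _ _] := mn.
  rewrite (row_end m n) //; last by lia.
  have -> : (q == p.+1) = false by apply/eqP; lia.
  have -> : (q == n) = false by apply/eqP; lia.
  by have -> : (q == 0%N) = false by apply/eqP; lia.
- rewrite row_full // eqxx mul1n ltr0n add0n.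
  (* There are [b 1] loops at [0]; if [b 1] were 0, [c 1] would be [beta ^+ 2 * r], beyond [r]. *)
  rewrite lt0n; apply/eqP => b1.
  have r0 : 0 < r.
    have : 0 < (1 + beta) * r.
      by have -> : (1 + beta) * r = 1 by rewrite mulrDl mul1r {1}r_l {1}l_r; ring.
    by rewrite pmulr_rgt0 // addr_gt0.
  have : c 1 = beta * beta * r by rewrite c_rec b1 subr0 c0 l_r; ring.
  have : r < beta * beta * r.
    by rewrite ltr_pMl // -expr2 exprn_egt1.
  have := c_le 1; lra.
- move=> p; have [fp|[m [n [j [vm mn jn pe]]]]] := full_or_block p.
    by rewrite row_full // eqxx.
  have [jn'|nj] := ltnP j.+1 n.
    by rewrite pe (row_inner m n j) // eqxx.
  by rewrite (row_end m n) ?eqxx //; lia.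
- move=> p; have [fp|[m [n [j [vm mn jn ->]]]]] := full_or_block p.
    have [ep _] := fp; have /andP[_ cr] := c_even p ep.
    by rewrite v_full // subr_gt0.
  rewrite (v_block m n j) // normr_gt0 (block_diff m n j) //.
  have [om _ _ _] := mn; have /andP[cm _] := c_odd m om.
  by rewrite mulf_neq0 ?expf_neq0 ?oppr_eq0 ?gt_eqF ?subr_gt0.
- move=> p; have [fp|[m [n [j [vm mn jn ->]]]]] := full_or_block p.
    by rewrite v_full //; have := c_ge p; rewrite r_l; lra.
  rewrite (v_block m n j) // ler_norml.
  have := c_ge (m + j); have := c_le (m + j); have := c_ge j; have := c_le j.
  by rewrite r_l => ????; apply/andP; split; lra.
- move=> p; have [fp|[m [n [j [vm mn jn pe]]]]] := full_or_block p.
    (* The image of the interval from [c p] to [r] consists of [b p.+1] intervals of length 1 and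
       the one from [l] to [c p.+1]. *)
    rewrite row_sum_full // v0 mulr1 (v_full p fp).
    rewrite (v_odd p.+1 (full_next p fp) (proj1 fp)).
    by rewrite c_rec l_r; ring.
  have [jn'|nj] := ltnP j.+1 n.
    rewrite pe (row_sum_inner m n j) // -addnS (v_block m n j.+1) // (v_block m n j) //.
    have [_ _ mb _] := mn; rewrite -[beta]gtr0_norm // -normrM.
    rewrite -normrN addnS !c_rec -addnS mb; last by lia.
    by congr (`|_|); ring.
  have [om /andP[n1 nm] _ _] := mn.
  have pe' : p.+1 = (m + n)%N by lia.
  have jE : n = j.+1 by lia.
  (* The image of the last interval of a block is cut into [gap] unit intervals and two end pieces,
     those of [p.+1] and [n]. Both vertices are visited, so their lengths reach from the orbit point
     to [l] or [r] according to parity. *)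
  have vn := mismatch_visited m n vm mn.
  have cn : c n = - beta * c j - (b n)%:R by rewrite jE c_rec.
  have vp : visited b p.+1 by rewrite pe'; exact: visited_mismatch.
  rewrite (row_sum_end m n) // v0 mulr1 pe (v_block m n j) // -pe.
  have [on|en] := boolP (odd n).
    have b_lt := mismatch_digit_odd m n mn on; rewrite -pe' in b_lt.
    have -> : gap (b n) (b p.+1) = (b n - b p.+1 - 1)%N by rewrite /gap; lia.
    have ej : ~~ odd j by rewrite jE in on.
    rewrite gtr0_norm; last by rewrite subr_gt0 pe (block_even m n j).
    rewrite v_even //; last by rewrite pe' oddD om on.
    rewrite (v_odd n) // !natrB; [|by lia|by lia].
    by rewrite cn c_rec r_l; ring.
  have b_lt := mismatch_digit_even m n mn en; rewrite -pe' in b_lt.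
  have -> : gap (b n) (b p.+1) = (b p.+1 - b n - 1)%N by rewrite /gap; lia.
  have oj : odd j by rewrite jE /= negbK in en.
  rewrite ltr0_norm; last by rewrite subr_lt0 pe (block_odd m n j).
  rewrite (v_odd p.+1) //; last by rewrite pe' oddD om (negbTE en).
  rewrite (v_even n) // !natrB; [|by lia|by lia].
  by rewrite cn c_rec r_l; ring.
- move=> p; pose f q := if q != 0%N then w q else 0.
  have -> : \sum_(q < p.+2 | q != 0 :> nat) A p q * w q = \sum_(q < p.+2) A p q * f q.
    by rewrite big_mkcond; apply: eq_bigr => q _; rewrite /f; case: ifP; rewrite ?mulr0.
  have [fp|[m [n [j [vm mn jn pe]]]]] := full_or_block p.
    by rewrite row_sum_full // mulr0 addr0 w_full // mulr1; exact: w_le.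
  have w_p : w p = theta by rewrite pe (w_block m n j).
  have [jn'|nj] := ltnP j.+1 n.
    rewrite w_p pe (row_sum_inner m n j) // (le_trans (w_le _)) //.
    by rewrite ler_peMl // ltW // (lt_trans ltr01).
  have [om /andP[n1 nm] _ _] := mn.
  have pe' : p.+1 = (m + n)%N by lia.
  have vn := mismatch_visited m n vm mn.
  have vp : visited b p.+1 by rewrite pe'; exact: visited_mismatch.
  have n0 : (n != 0)%N by lia.
  rewrite (row_sum_end m n) // mulr0 addr0 w_p /f n0 /= -expr2.
  (* As [m] is odd, [n] and [p.+1 = m + n] have opposite parities; the even one is full and has
     weight 1. *)
  apply: le_trans theta_sq; have [on|en] := boolP (odd n).
    have ep : ~~ odd p.+1 by rewrite pe' oddD om on.
    by rewrite lerD ?w_le // w_full //; split=> //; right.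
  by rewrite addrC lerD ?w_le // w_full //; split=> //; right.
- exact: lt_trans ltr01 theta_gt1.
Qed.

End MarkovDiagramOfOrbit.

(** Convergence in the product is coordinatewise, and the Hausdorff property identifies [lim] with
    the limit found. *)
Lemma digit_sequence_lim {R : realType} (F : set_system R) (FF : ProperFilter F)
    (u : R -> digit_sequence) (b : nat -> nat) :
  (forall i, \forall x \near F, u x i = b i) -> (lim (u x @[x --> F]) = b)%classic.
Proof.
move=> ub; apply: cvg_lim.
  by apply: hausdorff_product => i; exact: order_hausdorff.
apply/(pointwise_cvgP (U := nat) (V := nat)) => i.
exact: (cvg_near_cst (f := fun x => u x i) (b i) (ub i)).
Qed.

(** * The one-sided orbit of the left endpoint *)

Section QuasiExpansion.
Context {R : realType}.
Variable beta : R.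
Hypothesis beta_gt1 : 1 < beta.

Let beta_gt0 : 0 < beta := lt_trans ltr01 beta_gt1.
Let l : R := lbeta beta.
Let r : R := (beta + 1)^-1.

Let b1_neq0 : beta + 1 != 0.
Proof. by rewrite gt_eqF // addr_gt0. Qed.

Let r_l : r = l + 1.
Proof. by rewrite /r /l /lbeta; field. Qed.

Let l_r : l = - (beta * r).
Proof. by []. Qed.

Let l_lt_r : l < r.
Proof. by rewrite r_l ltrDl. Qed.

(* The digit of a point approached from above for even [n] and from below for
   odd [n]. *)
Definition side_digit (n : nat) (x : R) : int :=
  if odd n then Num.floor (- beta * x - l) else Num.ceil (- beta * x - l) - 1.

Fixpoint side_orbit (n : nat) : R :=
  if n is n'.+1 then - beta * side_orbit n' - (side_digit n' (side_orbit n'))%:~R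
  else l.

(** Entry 0 copies entry 1 as in [neg_beta_expansion], so [quasi_expansionE] is an equality of
    functions. *)
Definition side_expansion (i : nat) : nat :=
  `|side_digit i.-1 (side_orbit i.-1)|%N.

Local Notation c := side_orbit.
Local Notation b := side_expansion.

Lemma side_orbit_itv n : if odd n then l < c n <= r else l <= c n < r.
Proof.
elim: n => [|n _]; first by rewrite /= lexx l_lt_r.
rewrite /= /side_digit; case: (odd n) => /=.
  by have := floor_itv (- beta * c n - l); rewrite intrD r_l => /andP[]; lra.
by have := ceil_itv (- beta * c n - l); rewrite intrD r_l => /andP[]; lra.
Qed.

Lemma side_orbit_even n : ~~ odd n -> l <= c n < r.
Proof. by have := side_orbit_itv n; case: odd. Qed.

Lemma side_orbit_odd n : odd n -> l < c n <= r.
Proof. by have := side_orbit_itv n; case: odd. Qed.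

Lemma side_digit_ge0 n : 0 <= side_digit n (c n).
Proof.
have := side_orbit_itv n; rewrite /side_digit; case: odd => /andP[_ cr].
  rewrite floor_ge0 mulNr {1}l_r opprK addrC subr_ge0 ler_wpM2l // ltW //.
rewrite subr_ge0 -gtz0_ge1 ceil_gt0.
by rewrite mulNr {1}l_r opprK addrC subr_gt0 ltr_pM2l.
Qed.

Lemma side_expansionE n : (b n.+1)%:R = (side_digit n (c n))%:~R :> R.
Proof. by rewrite /side_expansion /= -[in RHS](gez0_abs (side_digit_ge0 n)). Qed.

Lemma side_orbitS n : c n.+1 = - beta * c n - (b n.+1)%:R.
Proof. by rewrite side_expansionE. Qed.

(** The digit at [c q] lies strictly below [- beta * c p - l]; being an integer, it is at most the
    ceiling minus 1 and hence at most the floor, so the side of approach does not matter. *)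
Lemma side_expansion_anti p q : c p < c q -> (b q.+1 <= b p.+1)%N.
Proof.
move=> cpq; rewrite -lez_nat /side_expansion /= !gez0_abs ?side_digit_ge0 //.
have ypq : - beta * c q - l < - beta * c p - l.
  by rewrite ltrD2r !mulNr ltrN2 ltr_pM2l.
have dq : (side_digit q (c q))%:~R < - beta * c p - l.
  apply: le_lt_trans ypq; rewrite /side_digit; case: odd.
    exact: floor_le.
  exact/ltW/ceilB1_lt.
rewrite {2}/side_digit; case: odd.
  by rewrite floor_ge_int ltW.
by rewrite lerBrDr lezD1 ceil_gt_int.
Qed.

Lemma side_expansion_eq p q : odd p = odd q -> c p = c q -> b p.+1 = b q.+1.
Proof. by move=> opq cpq; rewrite /side_expansion /side_digit /= opq cpq. Qed.

Let at_right_lt (e : R) : 0 < e -> (\forall x \near l^'+, 0 < x - l < e)%classic.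
Proof.
move=> e0; near=> x; apply/andP; split.
  by rewrite subr_gt0; near: x; exact: nbhs_right_gt.
by rewrite ltrBlDl; near: x; apply: nbhs_right_lt; rewrite ltrDl.
Unshelve. all: by end_near. Qed.

Let side_digit_near n : (\forall x \near l^'+,
  first_digit beta (c n + (- beta) ^+ n * (x - l)) = side_digit n (c n))%classic.
Proof.
have bn : 0 < beta ^+ n.+1 by rewrite exprn_gt0.
pose y := - beta * c n - l.
(* The distance to the next digit boundary in the direction of motion, divided by the factor
   [beta ^+ n.+1] by which [x - l] has been expanded. *)
pose e := (if odd n then (side_digit n (c n))%:~R + 1 - y
           else y - (side_digit n (c n))%:~R) / beta ^+ n.+1.
have e0 : 0 < e.
  rewrite /e divr_gt0 // /side_digit -/y; case: odd; rewrite subr_gt0.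
    by have /andP[_] := floor_itv y; rewrite intrD.
  exact: ceilB1_lt.
near=> x.
have : 0 < x - l < e by near: x; exact: at_right_lt.
move: (x - l) => d /andP[d0]; rewrite /e ltr_pdivlMr // => de.
rewrite /first_digit; apply: floor_def.
have -> : - beta * (c n + (- beta) ^+ n * d) - lbeta beta = y + (- beta) ^+ n.+1 * d.
  by rewrite /y exprS; ring.
have db : 0 < d * beta ^+ n.+1 by rewrite mulr_gt0.
rewrite exprNn -signr_odd /= (mulrC _ d) mulrA intrD.
move: de; rewrite /side_digit -/y; case: (odd n) => /= de.
  by rewrite mulr1; have /andP[h1 h2] := floor_itv y; lra.
rewrite mulrN1 mulNr; have := ceil_itv y; rewrite intrD => /andP[h1 h2]; lra.
Unshelve. all: by end_near. Qed.

Lemma iter_transform_near n : (\forall x \near l^'+,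
  iter n (neg_beta_transform beta) x = c n + (- beta) ^+ n * (x - l))%classic.
Proof.
elim: n => [|n IH]; first by apply: nearW => x /=; rewrite expr0; ring.
near=> x.
have xn : iter n (neg_beta_transform beta) x = c n + (- beta) ^+ n * (x - l).
  by near: x; exact: IH.
have dx : first_digit beta (c n + (- beta) ^+ n * (x - l)) = side_digit n (c n).
  by near: x; exact: side_digit_near.
by rewrite iterS xn /neg_beta_transform dx /= exprS; ring.
Unshelve. all: by end_near. Qed.

Lemma quasi_expansionE : quasi_expansion beta = side_expansion.
Proof.
apply: digit_sequence_lim => i; near=> x.
rewrite /neg_beta_expansion /side_expansion; congr `|_|%N.
have -> : iter i.-1 (neg_beta_transform beta) x = c i.-1 + (- beta) ^+ i.-1 * (x - l).
  by near: x; exact: iter_transform_near.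
by near: x; exact: side_digit_near.
Unshelve. all: by end_near. Qed.

End QuasiExpansion.

Theorem theorem2 (R : realType) (beta : R)
  (hbeta : (1 + Num.sqrt 5) / 2 < beta) :
  cmx_positive_recurrent (incidence_matrix beta).
Proof.
set theta : R := (1 + Num.sqrt 5) / 2 in hbeta.
have sqrt5 : (Num.sqrt 5 : R) ^+ 2 = 5 by rewrite sqr_sqrtr.
have sqrt5_gt1 : 1 < Num.sqrt 5 :> R.
  by rewrite -(ltr_pXn2r (n := 2)) ?nnegrE ?sqrtr_ge0 // sqrt5 expr1n ltr1n.
have theta_gt1 : 1 < theta by rewrite /theta; lra.
have theta_sq : 1 + theta = theta ^+ 2.
  by rewrite /theta expr_div_n sqrrD sqrt5; field.
have beta_gt1 : 1 < beta := lt_trans theta_gt1 hbeta.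
have -> : incidence_matrix beta =
    fun p q => (edge_count (side_expansion beta) p q)%:R.
  by rewrite -quasi_expansionE.
apply: (@diagram_positive_recurrent R (side_expansion beta) (side_orbit beta)
  beta (lbeta beta) (beta + 1)^-1 _ _ _ _ _ _ _ _ _ theta) => //.
- by rewrite /lbeta; field; rewrite gt_eqF // addr_gt0 // (lt_trans ltr01).
- exact: side_orbitS.
- exact: side_orbit_even.
- exact: side_orbit_odd.
- exact: side_expansion_anti.
- exact: side_expansion_eq.
- by rewrite theta_sq.
Qed.
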